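(* There is a universal constant $c>0$ such that the following holds. Let $K\subset\mathbb{R}^n$ be a convex body with $B_2^n\subset K\subset RB_2^n$. For every sufficiently small $\delta>0$, there exists a polytope $P_\delta\subset\mathbb{R}^n$ with no more than $\exp\left(c\log\left(\frac{2R}{\delta}\right)n\right)$ facets such that $$(1-\delta)P_\delta\subset K\subset P_\delta.$$
   Context: A convex body in $\mathbb{R}^n$ is a compact convex set with non-empty interior. $B_2^n$ is the Euclidean unit ball of $\mathbb{R}^n$ centered at the origin. A polytope is a compact convex polytope, and its number of facets is the number of its $(n-1)$-dimensional faces. For $t>0$ and a set $A$, $tA=\{tx : x\in A\}$. ''Sufficiently small $\delta$'' means $0<\delta<\delta_0$ for some universal constant $\delta_0>0$. *)

(* Defs.v *)
From mathcomp Require Import all_boot all_order all_algebra.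
From mathcomp Require Import all_classical all_reals all_analysis.
Import Order.TTheory GRing.Theory Num.Theory.
Import numFieldNormedType.Exports.

Set Implicit Arguments.
Unset Strict Implicit.
Unset Printing Implicit Defensive.

Local Open Scope classical_set_scope.
Local Open Scope ring_scope.

Section Defs.
Context {R : realType} {n : nat}.
Implicit Types (x y a : 'rV[R]_n) (b t : R) (A K P F : set 'rV[R]_n).

Definition dot x y : R := \sum_(i < n) x 0 i * y 0 i.

(* The library's norm on ['rV[R]_n] is the sup norm; it induces the same
   topology as [enorm]. *)
Definition enorm x : R := Num.sqrt (dot x x).

Definition scale t A : set 'rV[R]_n := [set t *: x | x in A].

Definition convex_body K : Prop :=
  [/\ compact K, convex_set K & K° !=set0].

(* A bounded solution set of a finite system of linear inequalities. *)
Definition polytope P : Prop :=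
  compact P /\
  exists (m : nat) (a : 'I_m -> 'rV[R]_n) (b : 'I_m -> R),
    P = [set x | forall i, dot (a i) x <= b i].

(* [a = 0] is allowed and gives the improper faces [set0] and [P]. *)
Definition face P F : Prop :=
  exists a b, P `<=` [set x | dot a x <= b] /\
              F = P `&` [set x | dot a x = b].

Definition affine_subspace (x : 'rV[R]_n) (U : {vspace 'rV[R]_n}) :
  set 'rV[R]_n := [set x + u | u in [set` U]].

Definition affine_hull A : set 'rV[R]_n :=
  smallest [set M | exists x U, M = affine_subspace x U] A.

Definition has_dim A (d : nat) : Prop :=
  exists x (U : {vspace 'rV[R]_n}),
    affine_hull A = affine_subspace x U /\ (\dim U = d)%VS.

(* [d.+1 = n] rather than [d = n.-1], which would be wrong for [n = 0]. *)
Definition facets P : set (set 'rV[R]_n) :=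
  [set F | face P F /\ exists2 d, d.+1 = n & has_dim F d].

End Defs.

Definition B2 (R : realType) (n : nat) : set 'rV[R]_n :=
  [set x | enorm x <= 1].
Arguments B2 : clear implicits.

(* Main.v *)
From HB Require Import structures.
Require Import Defs.
From mathcomp Require Import all_boot all_order all_algebra.
From mathcomp Require Import all_classical all_reals all_analysis.
From mathcomp Require Import ring lra.
Import Order.TTheory GRing.Theory Num.Theory.
Import numFieldNormedType.Exports.
Local Open Scope classical_set_scope.
Local Open Scope ring_scope.

(** Circumscribe [K] by its supporting halfspaces in the directions of a fine
    net of the unit ball: for points [a i] such that every unit vector is within
    [eps = delta / (4 * r)] of one of them, let [P] be the set of [x] with
    [dot (a i) x <= support_fun K (a i)] for all [i]. Clearly [K] lies in [P].
    Support functions are Lipschitz, so the finitely many inequalities control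
    every direction: [P] is bounded, and for each unit [u] the functional
    [dot u] exceeds the support function of [K] on [P] by at most [delta]
    ([dot_le_net], [enorm_le_net]). As [K] contains the unit ball, its support
    function is at least 1 on unit vectors, so this additive error is a
    multiplicative one, and [scale_net_sub] concludes by separating a point of
    [scale (1 - delta) P] outside [K] from [K].

    The number of facets is at most the number of inequalities
    ([card_facets_le]), because a facet is cut out of [P] by the equality case
    of one of them ([facet_tight]).

    The net must have at most [(C / eps) ^ n] points with [C] independent of the
    dimension. Instead of a volume argument, [ball_net] takes points of a cubic
    grid of step [eps / sqrt n] and counts them through their l1 norm: the
    integer coordinates of those needed have absolute values of sum at most
    [n / eps], so with [M] the integer part of [n / eps] there are at most
    [2 ^ n * 'C(n + M, n)] of them, and the binomial is exponential in [n]
    ([bin_le_expR]). *)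

(** * Euclidean geometry of row vectors *)

Lemma continuous_sumr (R : realType) (T : topologicalType) n
    (f : 'I_n -> T -> R) :
  (forall i, continuous (f i)) -> continuous (fun x => \sum_(i < n) f i x).
Proof.
by move=> fc x; apply: cvg_big => [|i _]; [exact: add_continuous|exact: fc].
Qed.

Section Dot.
Context {R : realType} {n : nat}.
Implicit Types (x y a p : 'rV[R]_n).

Lemma dot_is_linear a : linear (dot a : 'rV[R]_n -> R^o).
Proof.
move=> k x y; rewrite /dot scaler_sumr -big_split/=; apply: eq_bigr => i _.
by rewrite !mxE mulrDr mulrCA.
Qed.

HB.instance Definition _ a :=
  GRing.isLinear.Build R 'rV[R]_n R^o _ (dot a) (dot_is_linear a).

Lemma dotC x y : dot x y = dot y x.
Proof. by apply: eq_bigr => i _; rewrite mulrC. Qed.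

Lemma dotDr a x y : dot a (x + y) = dot a x + dot a y.
Proof. exact: linearD. Qed.

Lemma dotNr a x : dot a (- x) = - dot a x.
Proof. exact: linearN. Qed.

Lemma dotZr a k x : dot a (k *: x) = k * dot a x.
Proof. exact: linearZ. Qed.

Lemma dotDl a x y : dot (x + y) a = dot x a + dot y a.
Proof. by rewrite ![dot _ a]dotC dotDr. Qed.

Lemma dotNl a x : dot (- x) a = - dot x a.
Proof. by rewrite ![dot _ a]dotC dotNr. Qed.

Lemma dotZl a k x : dot (k *: x) a = k * dot x a.
Proof. by rewrite ![dot _ a]dotC dotZr. Qed.

Lemma dot0l a : dot 0 a = 0.
Proof. by rewrite -(scale0r 0) dotZl mul0r. Qed.

Definition dotE := (dotDl, dotDr, dotNl, dotNr, dotZl, dotZr).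

Lemma dot_ge0 x : 0 <= dot x x.
Proof. by apply: sumr_ge0 => i _; rewrite -expr2 sqr_ge0. Qed.

Lemma dot_eq0 x : dot x x = 0 -> x = 0.
Proof.
move=> /eqP; rewrite psumr_eq0; last by move=> i _; rewrite -expr2 sqr_ge0.
move=> /allP h; apply/rowP => i; rewrite mxE; apply/eqP.
by have := h i (mem_index_enum _); rewrite -expr2 sqrf_eq0.
Qed.

Lemma enorm_ge0 x : 0 <= enorm x.
Proof. exact: sqrtr_ge0. Qed.

Lemma enorm_sqr x : enorm x ^+ 2 = dot x x.
Proof. exact/sqr_sqrtr/dot_ge0. Qed.

Lemma enorm_gt0 x : x != 0 -> 0 < enorm x.
Proof.
move=> x0; rewrite lt_neqAle enorm_ge0 andbT eq_sym; apply: contra_neq x0 => nx.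
by apply: dot_eq0; rewrite -enorm_sqr nx expr0n.
Qed.

Lemma enormZ k x : enorm (k *: x) = `|k| * enorm x.
Proof.
by rewrite /enorm !dotE mulrA -expr2 sqrtrM ?sqr_ge0// sqrtr_sqr.
Qed.

Lemma enorm_normalize x : x != 0 -> enorm ((enorm x)^-1 *: x) = 1.
Proof.
move=> /enorm_gt0 x0.
by rewrite enormZ ger0_norm ?invr_ge0 ?enorm_ge0// mulVf ?gt_eqF.
Qed.

Lemma enormN x : enorm (- x) = enorm x.
Proof. by rewrite /enorm !dotE opprK. Qed.

(** Cauchy-Schwarz, from the square of [enorm y *: x - enorm x *: y]. *)
Lemma dot_le_enorm x y : dot x y <= enorm x * enorm y.
Proof.
have [->|/enorm_gt0 nx0] := eqVneq x 0.
  by rewrite dot0l mulr_ge0 ?enorm_ge0.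
have [->|/enorm_gt0 ny0] := eqVneq y 0.
  by rewrite dotC dot0l mulr_ge0 ?enorm_ge0.
have := dot_ge0 (enorm y *: x - enorm x *: y).
rewrite !dotE -!enorm_sqr (dotC y x) => h.
have : 0 <= (enorm x * enorm y) * (enorm x * enorm y - dot x y) by nra.
by rewrite pmulr_rge0 ?mulr_gt0// subr_ge0.
Qed.

Lemma normr_coord_le_enorm x i : `|x 0 i| <= enorm x.
Proof.
rewrite -sqrtr_sqr ler_sqrt ?dot_ge0// expr2 /dot (bigD1 i)//= lerDl.
by apply: sumr_ge0 => j _; rewrite -expr2 sqr_ge0.
Qed.

Lemma dot_continuous a : continuous (dot a).
Proof.
apply: (@continuous_sumr R 'rV[R]_n n (fun i x => a 0 i * x 0 i)) => i x.
have h := @coord_continuous R 1 n 0 i x.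
exact: cvgM (cvg_cst _) h.
Qed.

Lemma closed_halfspace a (b : R) : closed [set x | dot a x <= b].
Proof.
apply: (@preimage_closed _ _ (dot a) [set y : R | y <= b]); last exact: closed_le.
by move=> x _; exact: dot_continuous.
Qed.

Lemma compact_polyhedron {I : Type} (a : I -> 'rV[R]_n) (b : I -> R) (M : R) :
  [set x | forall i, dot (a i) x <= b i] `<=` [set x | enorm x <= M] ->
  compact [set x | forall i, dot (a i) x <= b i].
Proof.
move=> PM.
pose box : set 'rV[R]_n :=
  [set x | forall i, (`[- M, M]%classic : set R) (x 0 i)].
have boxc : compact box.
  apply: (@rV_compact R n (fun=> `[- M, M]%classic)) => i.
  exact: segment_compact.
apply: subclosed_compact boxc _ => [|x /PM /= xM i].
  rewrite [X in closed X](_ : _ =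
      \bigcap_(i in setT) [set x | dot (a i) x <= b i]); last first.
    by apply/seteqP; split=> x /= h i; [move=> _|]; exact: h.
  by apply: closed_bigI => i _; exact: closed_halfspace.
rewrite /box /= in_itv /= -ler_norml.
exact: le_trans (normr_coord_le_enorm _ _) xM.
Qed.

Lemma sqdist_continuous p :
  continuous (fun x : 'rV[R]_n => dot (x - p) (x - p)).
Proof.
pose f i (x : 'rV[R]_n) : R := (x - p) 0 i * (x - p) 0 i.
apply: (@continuous_sumr R 'rV[R]_n n f) => i x.
have xi := @coord_continuous R 1 n 0 i x.
have h : (fun y : 'rV[R]_n => (y - p) 0 i) y @[y --> x] --> (x - p) 0 i.
  rewrite (_ : (fun y => _) = (fun y : 'rV[R]_n => y 0 i - p 0 i)).
    by rewrite !mxE; exact: cvgB xi (cvg_cst _).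
  by apply/funext => y; rewrite !mxE.
exact: (cvgM h h).
Qed.

End Dot.

(** * Facets of a polyhedron *)

Section Facets.
Context {R : realType} {n : nat}.
Implicit Types (x y a p : 'rV[R]_n) (F : set 'rV[R]_n).

Lemma hyperplane_affine a p :
  [set x | dot a x = dot a p] = affine_subspace p (lker (linfun (dot a))).
Proof.
apply/seteqP; split=> [x /= ax|_ [u /= uW <-] /=].
  exists (x - p); last by rewrite addrC subrK.
  by rewrite /= memv_ker lfunE /= !dotE ax subrr.
by move: uW; rewrite memv_ker lfunE /= !dotE => /eqP ->; rewrite addr0.
Qed.

(** The kernel of a nonzero functional is a proper subspace, so its dimension
    is at most that of [U]. *)
Lemma hyperplane_direction_max a (U : {vspace 'rV[R]_n}) :
  a != 0 -> (\dim U).+1 = n -> (U <= lker (linfun (dot a)))%VS ->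
  U = lker (linfun (dot a)).
Proof.
move=> a0 dU UW; apply/eqP; rewrite eqEdim UW /= -ltnS dU ltnNge.
apply/negP => dW.
have /subvP /(_ a (memvf _)) : (fullv <= lker (linfun (dot a)))%VS.
  suff /eqP -> : lker (linfun (dot a)) == fullv by [].
  by rewrite eqEdim subvf dimvf /dim /= mul1n.
rewrite memv_ker lfunE /= => /eqP /dot_eq0 /eqP.
by rewrite (negbTE a0).
Qed.

(** Affine subspaces are nonempty here, and two distinct points have disjoint
    singletons, so the intersection of all affine subspaces is empty. This
    keeps [set0] from being a facet. *)
Lemma affine_hull_set0 x (U : {vspace 'rV[R]_n}) :
  (0 < n)%N -> affine_hull set0 <> affine_subspace x U.
Proof.
move=> n0 E.
have h y : x = y.
  have : affine_hull set0 x by rewrite E; exists 0; rewrite /= ?mem0v ?addr0.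
  move=> /(_ (affine_subspace y 0)) [].
    by split; [exists y, 0%VS|exact: sub0set].
  by move=> u /=; rewrite memv0 => /eqP -> <-; rewrite addr0.
have : (0 : 'rV[R]_n) = const_mx 1 by rewrite -(h 0); exact: h.
by move=> /rowP /(_ (Ordinal n0)); rewrite !mxE => /esym /eqP; rewrite oner_eq0.
Qed.

Lemma dot_avg m (f : 'I_m -> 'rV[R]_n) a p :
  dot a (m.+1%:R^-1 *: (p + \sum_i f i))
  = m.+1%:R^-1 * (dot a p + \sum_i dot a (f i)).
Proof. by rewrite dotZr dotDr; congr (_ * (_ + _)); rewrite linear_sum. Qed.

Lemma small_step (m : nat) (g D : 'I_m -> R) :
  (forall i, 0 < g i) -> exists2 t, 0 < t & forall i, t * D i <= g i.
Proof.
move=> g0; pose s i := g i / (1 + `|D i|).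
have D0 i : 0 < 1 + `|D i| by rewrite ltr_pwDl.
exists (\big[Order.min/1]_i s i).
  apply: lt_bigmin => // i _; exact: divr_gt0.
move=> i; apply: (@le_trans _ _ (s i * `|D i|)).
  apply: (@le_trans _ _ ((\big[Order.min/1]_i s i) * `|D i|)).
    rewrite ler_wpM2l ?ler_norm//.
    by apply/ltW/lt_bigmin => // j _; exact: divr_gt0.
  by rewrite ler_wpM2r// bigmin_le_cond.
by rewrite /s mulrAC ler_pdivrMr// ler_wpM2l ?ltW// ltrDr.
Qed.

(** If some constraint with [a i != 0] is tight on all of [F], the hyperplane
    [dot (a i) x = b i] contains the affine hull of [F] and has the same
    dimension, hence equals it; so it cuts out of [P] exactly [F]. Otherwise
    each constraint with [a i != 0] is slack at some point of [F], and the
    average of these points is a point [c] of [F] at which all of them are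
    slack. From [c] one can move a little within [P] in any direction; moving in
    a direction [v] outside [U] that does not decrease [dot a0] cannot leave
    [F], although it leaves the affine hull of [F]: a contradiction. *)
Lemma facet_tight m (a : 'I_m -> 'rV[R]_n) (b : 'I_m -> R) F
    (P := [set x | forall i, dot (a i) x <= b i]) :
  facets P F -> exists i, F = P `&` [set x | dot (a i) x = b i].
Proof.
move=> [[a0 [b0 [Pab FE]]] [d dn [x0 [U [hullE dimU]]]]].
have [[p Fp]|F0] := pselect (F !=set0); last first.
  exfalso; apply: (@affine_hull_set0 x0 U); first by rewrite -dn.
  rewrite -hullE; congr affine_hull; apply/esym/seteqP; split=> // x Fx.
  by apply: F0; exists x.
have FU : F `<=` affine_subspace x0 U.
  by rewrite -hullE; exact: sub_gen_smallest.
have Ux0 : affine_subspace x0 U x0 by exists 0; rewrite /= ?mem0v ?addr0.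
have hull_sub c : F `<=` [set x | dot c x = dot c p] ->
    affine_subspace x0 U `<=` [set x | dot c x = dot c p].
  move=> Fc; rewrite -hullE; apply: smallest_sub => //.
  by exists p, (lker (linfun (dot c))); exact: hyperplane_affine.
have [pP a0p] : P p /\ dot a0 p = b0 by move: Fp; rewrite FE.
have UW c : F `<=` [set x | dot c x = dot c p] ->
    (U <= lker (linfun (dot c)))%VS.
  move=> /hull_sub Uc; apply/subvP => u uU.
  have /Uc : affine_subspace x0 U (x0 + u) by exists u.
  rewrite /= dotDr (Uc _ Ux0) memv_ker lfunE /= => /eqP.
  by rewrite -subr_eq0 addrAC subrr add0r.
have FS : F = P `&` [set x | dot a0 x = dot a0 p] by rewrite a0p.
have [[i [ai Fi]]|noi] := pselect (exists i, a i != 0 /\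
    F `<=` [set x | dot (a i) x = b i]).
  exists i; rewrite -(Fi p Fp).
  have Fi' : F `<=` [set x | dot (a i) x = dot (a i) p].
    by move=> x /Fi /= ->; rewrite (Fi p Fp).
  have UE : U = lker (linfun (dot (a i))).
    by apply: hyperplane_direction_max => //; [rewrite dimU dn|exact: UW].
  apply/seteqP; split=> x.
    by move=> Fx; split; [move: Fx; rewrite FE => -[]|exact: Fi'].
  move=> [Px /= aix]; rewrite FS; split => //=.
  have : x - p \in lker (linfun (dot a0)).
    apply: (subvP (UW a0 _)); first by rewrite FS => y [].
    by rewrite UE memv_ker lfunE /= !dotE aix subrr.
  by rewrite memv_ker lfunE /= !dotE subr_eq0 => /eqP.
exfalso.
(* Zero normals give constraints that no step can violate; [f i] is then just
   some point of [F]. *)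
have /choice[f Hf] : forall i, exists y, F y /\ (a i != 0 -> dot (a i) y < b i).
  move=> i; have [ai0|ai] := eqVneq (a i) 0; first by exists p.
  have /existsNP [y /not_implyP [Fy /= ney]] :
      ~ F `<=` [set x | dot (a i) x = b i].
    by move=> Fi; apply: noi; exists i.
  exists y; split=> // _; rewrite lt_neqAle; apply/andP.
  split; first exact/eqP.
  by move: Fy; rewrite FE => -[/(_ i)].
have fP i : P (f i) by case: (Hf i) => + _; rewrite FE => -[].
have fa0 i : dot a0 (f i) = dot a0 p.
  by case: (Hf i) => + _; rewrite FS => -[].
pose c : 'rV[R]_n := m.+1%:R^-1 *: (p + \sum_i f i).
have m0 : 0 < m.+1%:R :> R by rewrite ltr0n.
have a0c : dot a0 c = dot a0 p.
  rewrite /c dot_avg (eq_bigr (fun=> dot a0 p)) => [|i _]; last exact: fa0.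
  rewrite sumr_const card_ord -mulrS -(mulr_natl (dot a0 p)).
  by rewrite mulrA mulVf ?mul1r// gt_eqF.
have ac j : a j != 0 -> dot (a j) c < b j.
  move=> aj; rewrite /c dot_avg mulrC ltr_pdivrMr// mulr_natr mulrS.
  apply: ler_ltD; first exact: pP.
  have -> : b j *+ m = \sum_(i < m) b j by rewrite sumr_const card_ord.
  rewrite (bigD1 j)//= [X in _ < X](bigD1 j)//=.
  apply: ltr_leD; first exact: (proj2 (Hf j)).
  by apply: ler_sum => i _; exact: fP.
have [v vU av] : exists2 v, v \notin U & 0 <= dot a0 v.
  have /subvPn [v _ vU] : ~~ (fullv <= U)%VS.
    apply/negP => /dimvS; rewrite dimvf dimU /dim /= mul1n -dn ltnn//.
  have [?|?] := leP 0 (dot a0 v); first by exists v.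
  by exists (- v); rewrite ?memvN// dotNr oppr_ge0 ltW.
have gap i : 0 < (if a i == 0 then 1 else b i - dot (a i) c).
  by case: ifPn => [_|/ac]; rewrite ?subr_gt0 ?ltr01.
have [t t0 tP] := small_step m _ (fun i => dot (a i) v) gap.
have zP : P (c + t *: v).
  move=> i; rewrite dotDr (dotZr _ t); have /= := tP i.
  case: ifPn => [/eqP ai0 _|_ ti].
    by have := pP i; rewrite ai0 !dot0l mulr0 addr0.
  by rewrite -lerBrDl.
have zF : F (c + t *: v).
  rewrite FS; split=> //=; apply/eqP; rewrite eq_le; apply/andP; split.
    by rewrite a0p; exact: Pab.
  by rewrite dotDr (dotZr _ t) a0c lerDl mulr_ge0// ltW.
have cF : F c.
  rewrite FS; split=> //= i.
  have [ai0|/ac/ltW//] := eqVneq (a i) 0.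
  by have := pP i; rewrite ai0 !dot0l.
have [[u1 /= u1U e1] [u2 /= u2U e2]] := (FU _ zF, FU _ cF).
move/negP: vU; apply.
have -> : v = t^-1 *: (u1 - u2).
  have -> : u1 - u2 = t *: v.
    have -> : t *: v = (c + t *: v) - c by rewrite addrAC subrr add0r.
    by rewrite -e1 -e2 opprD addrACA subrr add0r.
  by rewrite scalerA mulVf ?scale1r// gt_eqF.
by rewrite memvZ// memvB.
Qed.

Lemma card_facets_le m (a : 'I_m -> 'rV[R]_n) (b : 'I_m -> R)
    (P := [set x | forall i, dot (a i) x <= b i]) :
  exists2 N : nat, (facets P #= `I_N)%card & (N <= m)%N.
Proof.
have sub : facets P `<=` range (fun i => P `&` [set x | dot (a i) x = b i]).
  by move=> F /facet_tight [i ->]; exists i.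
have le : (facets P #<= [set: 'I_m])%card.
  exact: card_le_trans (subset_card_le sub) (card_image_le _ _).
have /finite_setP [N NE] : finite_set (facets P).
  by apply: card_le_finite le _; exact: finite_finset.
exists N => //; rewrite -card_le_II -(card_le_eql NE).
by rewrite (card_le_eqr card_II).
Qed.

End Facets.

(** * A net of the unit ball with few points *)

Section Net.
Context {R : realType}.

(** [n ^ n / n`!] is one term of the exponential series at [n]. *)
Lemma natXn_le_fact_expR (n : nat) : (n%:R : R) ^+ n <= n`!%:R * expR 1 ^+ n.
Proof.
case: n => [|n]; first by rewrite !expr0 mulr1.
rewrite mulrC -ler_pdivrMr ?ltr0n ?fact_gt0// -expRM_natr mul1r.
by apply: le_trans (expR_ge1Dxn n (ler0n _ _)); rewrite lerDr.
Qed.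

Lemma ffact_le_expn m n : (m ^_ n <= m ^ n)%N.
Proof.
elim: n => // n IH; rewrite ffactnSr expnSr leq_mul// leq_subr//.
Qed.

(** [(n + M) ^ n / n`!] bounds the binomial; comparing [n`!] with [(n / e) ^ n]
    leaves [(e * (n + M) / n) ^ n], where the dimension has cancelled. *)
Lemma bin_le_expR (n : nat) (y : R) : 0 <= y ->
  'C(n + Num.truncn (n%:R * y), n)%:R <= (expR 1 * (1 + y)) ^+ n.
Proof.
move=> y0; case: n => [|n]; first by rewrite expr0 add0n bin0.
set M := Num.truncn _.
have ny0 : 0 <= n.+1%:R * y by rewrite mulr_ge0.
have MnR : M%:R <= n.+1%:R * y by rewrite truncn_le.
have n0 : 0 < n.+1%:R ^+ n.+1 :> R by rewrite exprn_gt0.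
rewrite -(ler_pM2r n0).
apply: (@le_trans _ _
  ('C(n.+1 + M, n.+1)%:R * ((n.+1)`!%:R * expR 1 ^+ n.+1))).
  by rewrite ler_wpM2l// natXn_le_fact_expR.
rewrite mulrA -natrM bin_ffact -exprMn -mulrA [X in _ <= X]exprMn mulrC.
rewrite ler_wpM2l ?exprn_ge0 ?expR_ge0//.
apply: (@le_trans _ _ ((n.+1 + M)%:R ^+ n.+1)).
  by rewrite -natrX ler_nat ffact_le_expn.
rewrite lerXn2r ?nnegrE ?mulr_ge0 ?addr_ge0// natrD; nra.
Qed.

Lemma sum_norm_le_enorm n (x : 'rV[R]_n) :
  \sum_i `|x 0 i| <= Num.sqrt n%:R * enorm x.
Proof.
have -> : \sum_i `|x 0 i| = dot (const_mx 1) (\row_i `|x 0 i|).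
  by apply: eq_bigr => i _; rewrite !mxE mul1r.
apply: le_trans (dot_le_enorm _ _) _.
have -> : enorm (const_mx 1 : 'rV[R]_n) = Num.sqrt n%:R.
  congr Num.sqrt; rewrite /dot (eq_bigr (fun=> 1)).
    by rewrite sumr_const card_ord.
  by move=> i _; rewrite mxE mul1r.
have -> // : enorm (\row_i `|x 0 i|) = enorm x.
congr Num.sqrt; apply: eq_bigr => i _.
by rewrite !mxE -!expr2 real_normK ?num_real.
Qed.

(** The net consists of points of the grid of step [s = eps / sqrt n], whose
    cells have diameter [eps]. Each coordinate of [u] is rounded towards zero,
    so the multiples [k i] of [s] obtained satisfy
    [\sum_i k i <= sqrt n * enorm u / s <= n / eps]. The grid points are thus
    indexed by a sign vector and a sequence of [n] naturals of sum at most
    [n / eps]. Counting by this sum, instead of by the range of each single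
    coordinate, is what avoids a factor [sqrt n ^ n]. *)
Lemma ball_net n (eps : R) : (0 < n)%N -> 0 < eps ->
  exists m (a : 'I_m -> 'rV[R]_n),
    m%:R <= (2 * expR 1 * (1 + eps^-1)) ^+ n /\
    forall u, enorm u <= 1 -> exists i, enorm (a i - u) <= eps.
Proof.
move=> n0 eps0; set M := Num.truncn (n%:R * eps^-1).
pose s : R := eps / Num.sqrt n%:R.
have sn0 : 0 < Num.sqrt n%:R :> R by rewrite sqrtr_gt0 ltr0n.
have sn2 : Num.sqrt n%:R ^+ 2 = n%:R :> R by rewrite sqr_sqrtr.
have s0 : 0 < s by rewrite divr_gt0.
pose A := [set t : n.-tuple 'I_M.+1 | (\sum_(i <- t) i <= M)%N]%SET.
pose I := ({t | t \in A} * {ffun 'I_n -> bool})%type.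
pose pt (z : I) : 'rV[R]_n :=
  \row_i (s * ((-1) ^+ z.2 i * (tnth (val z.1) i : nat)%:R)).
exists #|{: I}|, (pt \o enum_val); split.
  rewrite card_prod card_sig card_partial_ord_partitions.
  rewrite card_ffun card_bool card_ord.
  rewrite natrM natrX mulrC -mulrA exprMn ler_wpM2l ?exprn_ge0//.
  by apply: bin_le_expR; rewrite invr_ge0 ltW.
move=> u u1.
pose k i := Num.truncn (`|u 0 i| / s).
have us i : 0 <= `|u 0 i| / s by rewrite divr_ge0// ltW.
have ki i := truncn_itv (us i).
have ksum : (\sum_i k i <= M)%N.
  rewrite /M truncn_ge_nat; last by rewrite mulr_ge0// invr_ge0 ltW.
  rewrite natr_sum.
  apply: (@le_trans _ _ (\sum_i (`|u 0 i| / s))).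
    by apply: ler_sum => i _; case/andP: (ki i).
  rewrite -mulr_suml ler_pdivrMr// /s.
  apply: le_trans (sum_norm_le_enorm _ _) _.
  rewrite -[X in X / eps]sn2; apply: (@le_trans _ _ (Num.sqrt n%:R)).
    by rewrite ler_piMr// ltW.
  by rewrite le_eqVlt; apply/orP; left; apply/eqP; field; rewrite !gt_eqF.
have kM i : (k i < M.+1)%N.
  by rewrite ltnS (leq_trans _ ksum)// (bigD1 i)//= leq_addr.
pose t := [tuple Ordinal (kM i) | i < n].
have tA : t \in A.
  by rewrite inE big_tuple (eq_bigr k)// => i _; rewrite tnth_mktuple.
pose z : I := (exist _ t tA, [ffun i => u 0 i < 0]).
exists (enum_rank z); rewrite /= enum_rankK.
rewrite -(@ler_pXn2r _ 2) ?nnegrE ?enorm_ge0 ?(ltW eps0)// enorm_sqr.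
have -> : eps ^+ 2 = \sum_(i < n) s ^+ 2.
  rewrite sumr_const card_ord -mulr_natr /s expr_div_n sn2 divfK//.
  by rewrite gt_eqF// ltr0n.
rewrite /dot; apply: ler_sum => i _.
rewrite !mxE /= tnth_mktuple ffunE /= -expr2.
rewrite -[X in X <= _]real_normK ?num_real// ler_pXn2r ?nnegrE ?(ltW s0)//.
have uS : u 0 i = (-1) ^+ (u 0 i < 0)%R * `|u 0 i| by rewrite -numEsign.
have /andP [k1 k2] := ki i; rewrite -/(k i) in k1 k2.
have uE : `|u 0 i| = s * (`|u 0 i| / s) by rewrite mulrC divfK// gt_eqF.
rewrite [X in _ - X]uS mulrCA -mulrBr normrMsign uE -mulrBr normrM gtr0_norm//.
by rewrite ler_piMr ?(ltW s0)// distrC ger0_norm ?subr_ge0// lerBlDl natr1 ltW.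
Qed.

End Net.

(** * Separating a point from a compact convex set *)

Section Separation.
Context {R : realType} {n : nat}.
Implicit Types (x y a p : 'rV[R]_n) (K : set 'rV[R]_n).

Lemma convex_segment K x y (t : R) : convex_set K -> K x -> K y ->
  0 <= t -> t <= 1 -> K (x + t *: (y - x)).
Proof.
move=> cK Kx Ky t0 t1.
have /set_mem := cK y x (Itv01 t0 t1) (mem_set Ky) (mem_set Kx).
rewrite [X in K X -> _](_ : _ = t *: y + (1 - t) *: x)//.
by rewrite scalerBl scale1r scalerBr addrCA.
Qed.

(** The normal is [w = p - q], where [q] is the point of [K] nearest to [p]: a
    point [x] of [K] with [dot w q < dot w x] would make [q + t *: (x - q)]
    nearer to [p] than [q] for small [t > 0]. *)
Lemma convex_separation K p : convex_set K -> compact K -> K !=set0 -> ~ K p ->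
  exists u, enorm u = 1 /\ forall x, K x -> dot u x <= dot u p.
Proof.
move=> cK kK K0 Kp.
have sqc : {within K, continuous (fun x : 'rV[R]_n => dot (x - p) (x - p))}.
  exact/continuous_subspaceT/sqdist_continuous.
have [q /set_mem Kq qmin] := compact_EVT_min K0 kK sqc.
pose w := p - q.
have w0 : w != 0.
  by rewrite subr_eq0; apply/eqP => pq; apply: Kp; rewrite pq.
have wx x : K x -> dot w x <= dot w q.
  move=> Kx; rewrite leNgt; apply/negP => wqx.
  pose g := dot w (x - q); pose D := dot (x - q) (x - q).
  have g0 : 0 < g by rewrite /g dotDr dotNr subr_gt0.
  have D0 : 0 <= D by exact: dot_ge0.
  have gD : 0 < g + D by rewrite ltr_wpDr.
  (* The squared distance to [p] changes by [t * (t * D - 2 * g)]; this [t] is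
     at most 1 and makes [t * D <= g]. *)
  pose t := g / (g + D).
  have t0 : 0 < t by rewrite divr_gt0.
  have t1 : t <= 1 by rewrite ler_pdivrMr// mul1r lerDl.
  have := qmin _ (mem_set (convex_segment _ _ _ _ cK Kq Kx (ltW t0) t1)).
  have -> : q + t *: (x - q) - p = t *: (x - q) - w.
    by rewrite /w opprB addrA (addrC q).
  have -> : q - p = - w by rewrite /w opprB.
  have -> : dot (t *: (x - q) - w) (t *: (x - q) - w)
            = dot (- w) (- w) - t * (2 * g - t * D).
    rewrite dotDl !(dotDr _ (t *: (x - q)) (- w)) !(dotZl, dotZr, dotNl, dotNr).
    rewrite (dotC _ w) -/g -/D; ring.
  rewrite lerBrDr gerDl pmulr_rle0// => h.
  have tD : t * D <= g.
    by rewrite /t mulrAC ler_pdivrMr// ler_wpM2l ?(ltW g0)// lerDr ltW.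
  lra.
exists ((enorm w)^-1 *: w); split; first exact: enorm_normalize.
move=> x Kx; rewrite !dotZl ler_wpM2l ?invr_ge0 ?enorm_ge0//.
apply: le_trans (wx x Kx) _.
by rewrite -subr_ge0 -dotNr -dotDr dot_ge0.
Qed.

End Separation.

(** * Circumscribing with the normals of a net *)

Section Approximation.
Context {R : realType} {n : nat}.
Implicit Types (x y a p u : 'rV[R]_n) (K : set 'rV[R]_n).

Definition support_fun K a : R := sup [set dot a x | x in K].

Context (K : set 'rV[R]_n) (r : R).
Context (B2K : B2 R n `<=` K) (KrB2 : forall x, K x -> enorm x <= r).

Let K0 : K 0.
Proof. by apply: B2K; rewrite /B2 /= /enorm dot0l sqrtr0. Qed.

Lemma dot_le_support a x : K x -> dot a x <= support_fun K a.
Proof.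
move=> Kx; apply: ub_le_sup; last by exists x.
exists (enorm a * r) => _ [y Ky <-].
by apply: le_trans (dot_le_enorm _ _) _; rewrite ler_wpM2l ?enorm_ge0 ?KrB2.
Qed.

Lemma support_le a c : (forall x, K x -> dot a x <= c) -> support_fun K a <= c.
Proof.
move=> h; apply: ge_sup; last by move=> _ [x Kx <-]; exact: h.
by exists (dot a 0); exists 0.
Qed.

Lemma support_ge1 u : enorm u = 1 -> 1 <= support_fun K u.
Proof.
move=> u1; have <- : dot u u = 1 by rewrite -enorm_sqr u1 expr1n.
by apply/dot_le_support/B2K; rewrite /B2 /= u1.
Qed.

Lemma support_le_enorm u : enorm u = 1 -> support_fun K u <= r.
Proof.
move=> u1; apply: support_le => x Kx.
by apply: le_trans (dot_le_enorm _ _) _; rewrite u1 mul1r KrB2.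
Qed.

Context (m : nat) (a : 'I_m -> 'rV[R]_n) (eps : R).
Context (net : forall u, enorm u <= 1 -> exists i, enorm (a i - u) <= eps).

Let P := [set x | forall i, dot (a i) x <= support_fun K (a i)].

(** The functionals [dot u] and [dot (a i)] differ by at most [eps * enorm x] at
    [x], and the support functions at [u] and [a i] by at most [eps * r]. *)
Lemma dot_le_net u x : P x -> enorm u = 1 ->
  dot u x <= support_fun K u + eps * (r + enorm x).
Proof.
move=> Px u1; have [i ai] := net u ltac:(by rewrite u1).
have h1 : support_fun K (a i) <= support_fun K u + eps * r.
  apply: support_le => y Ky.
  rewrite -(subrK u (a i)) dotDl addrC lerD ?dot_le_support//.
  by apply: le_trans (dot_le_enorm _ _) _; rewrite ler_pM ?enorm_ge0 ?KrB2.
have h2 : dot (u - a i) x <= eps * enorm x.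
  apply: le_trans (dot_le_enorm _ _) _; rewrite ler_wpM2r ?enorm_ge0//.
  by rewrite -opprB enormN.
have := Px i; have : dot u x = dot (a i) x + dot (u - a i) x.
  by rewrite -dotDl addrC subrK.
lra.
Qed.

(** Testing [dot_le_net] in the direction of [x] itself gives
    [enorm x <= r + eps * (r + enorm x)], which is absorbed as [eps <= 1/4]. *)
Lemma enorm_le_net x : 0 < r -> eps <= 1/4 -> P x -> enorm x <= 3 * r.
Proof.
move=> r0 e4 Px; have [->|x0] := eqVneq x 0.
  by rewrite /enorm dot0l sqrtr0 mulr_ge0// ltW.
have u1 := enorm_normalize _ x0.
have := dot_le_net _ _ Px u1; rewrite dotZl -enorm_sqr expr2.
rewrite mulKf ?gt_eqF ?enorm_gt0//.
have := support_le_enorm _ u1.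
nra.
Qed.

(** Since [enorm x <= 3 * r], the error [eps * (r + enorm x)] is at most
    [delta], hence at most [delta * support_fun K u] because [K] contains the
    unit ball. So [dot u x <= (1 + delta) * support_fun K u] for every unit [u],
    and [(1 - delta) * (1 + delta) < 1] leaves no room to separate
    [(1 - delta) *: x] from [K]. *)
Lemma scale_net_sub x (delta : R) : convex_set K -> compact K ->
  0 < r -> 0 < delta -> delta < 1 -> eps <= 1/4 -> 4 * r * eps <= delta ->
  P x -> K ((1 - delta) *: x).
Proof.
move=> cK kK r0 d0 d1 e4 er Px; apply: contrapT => nK.
have Kn0 : K !=set0 by exists 0.
have [u [u1 /support_le hu]] := convex_separation _ _ cK kK Kn0 nK.
move: hu; rewrite dotZr.
have := dot_le_net _ _ Px u1; have := enorm_le_net _ r0 e4 Px.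
have := support_ge1 _ u1.
have e0 : 0 <= eps.
  by have [i] := net u ltac:(by rewrite u1); exact: le_trans (enorm_ge0 _).
set h := support_fun K u => h1 x3 ux.
have : dot u x <= (1 + delta) * h by nra.
nra.
Qed.

End Approximation.

(** * The number of facets *)

Lemma expR1_le4 (R : realType) : expR 1 <= 4 :> R.
Proof.
have h : expR (- (1/2)) >= 1/2 :> R.
  by apply: le_trans (expR_ge1Dx _); lra.
have e0 := expR_gt0 (1/2 : R).
have e2 : expR (1/2) <= 2 :> R.
  by move: h; rewrite expRN -(@ler_pM2r _ (expR (1/2))) // mulVf ?gt_eqF//; lra.
have -> : 1 = 1/2 + 1/2 :> R by lra.
rewrite expRD; nra.
Qed.

(** With [y = 2 * r / delta >= 2], the base is [2 * e * (1 + 2 * y)], at most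
    [5 * e * y <= 20 * y <= y ^+ 6]. *)
Lemma net_size_le (R : realType) n (r delta : R) :
  1 <= r -> 0 < delta -> delta < 1 ->
  (2 * expR 1 * (1 + (delta / (4 * r))^-1)) ^+ n
    <= expR (6 * ln (2 * r / delta) * n%:R).
Proof.
move=> r1 d0 d1; set y := 2 * r / delta.
have r0 : 0 < r by lra.
have y2 : 2 <= y by rewrite /y ler_pdivlMr//; nra.
have yE : (delta / (4 * r))^-1 = 2 * y.
  by rewrite /y; field; rewrite !gt_eqF.
rewrite expRM_natr lerXn2r ?nnegrE ?expR_ge0//.
  by rewrite yE !mulr_ge0 ?expR_ge0//; lra.
rewrite (mulrC 6) expRM_natr lnK ?posrE; last by lra.
have y5 : 32 <= y ^+ 5.
  have <- : 2 ^+ 5 = 32 :> R by ring.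
  by rewrite lerXn2r ?nnegrE//; lra.
rewrite exprS yE; have := expR1_le4 R; have := expR_gt0 (1 : R).
have : 2 * (1 + 2 * y) <= 5 * y by lra.
nra.
Qed.

(** * The approximation theorem *)

Theorem proposition1p5 (R : realType) :
  exists c : R, 0 < c /\
  exists delta0 : R, 0 < delta0 /\
  forall (n : nat) (K : set 'rV[R]_n) (r : R),
    convex_body K -> 0 < r ->
    B2 R n `<=` K -> K `<=` scale r (B2 R n) ->
    forall delta : R, 0 < delta -> delta < delta0 ->
    exists P : set 'rV[R]_n,
      [/\ polytope P,
          exists2 N : nat, (facets P #= `I_N)%card
            & N%:R <= expR (c * ln (2 * r / delta) * n%:R),
          scale (1 - delta) P `<=` K
        & K `<=` P].
Proof.
exists 6; split=> //; exists 1; split=> //.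
move=> n K r [kK cK _] r0 B2K KrB delta d0 d1.
have KrB2 x : K x -> enorm x <= r.
  move=> /KrB [y /= y1 <-]; rewrite enormZ gtr0_norm//.
  by rewrite ler_piMr// ltW.
(* In dimension 0 the body is the whole space, a polytope without facets. *)
have [n0|n0] := posnP n.
  subst n.
  have K1 x : K x by apply: B2K; rewrite /B2 /= /enorm /dot big_ord0 sqrtr0.
  exists K; split=> //.
  - split=> //; exists 0%N, (fun=> 0), (fun=> 0).
    by apply/seteqP; split=> [x _ []//|x _]; exact: K1.
  - exists 0%N; last by rewrite mulr0 expR0.
    rewrite II0 card_eq0; apply/eqP.
    by apply/seteqP; split=> [F [_ [e]]//|].
have r1 : 1 <= r.
  pose e : 'rV[R]_n := delta_mx 0 (Ordinal n0).
  have e1 : enorm e = 1.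
    rewrite /enorm /dot (bigD1 (Ordinal n0))//= big1 ?addr0; last first.
      by move=> i ie; rewrite !mxE (negbTE ie) mulr0.
    by rewrite !mxE !eqxx mulr1 sqrtr1.
  by rewrite -e1; apply/KrB2/B2K; rewrite /B2 /= e1.
pose eps := delta / (4 * r).
have eps0 : 0 < eps by rewrite divr_gt0// mulr_gt0.
have epsE : 4 * r * eps = delta by rewrite /eps mulrC divfK// gt_eqF// mulr_gt0.
have eps4 : eps <= 1/4 by nra.
have [m [a [ma net]]] := ball_net n eps n0 eps0.
pose P := [set x | forall i, dot (a i) x <= support_fun K (a i)].
exists P; split.
- split; last by exists m, a, (fun i => support_fun K (a i)).
  apply: (@compact_polyhedron _ _ _ _ _ (3 * r)) => x Px.
  exact: (enorm_le_net K r B2K KrB2 m a eps net).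
- have [N NE Nm] := card_facets_le m a (fun i => support_fun K (a i)).
  exists N => //; apply: le_trans (net_size_le R n r delta r1 d0 d1).
  by apply: le_trans ma; rewrite ler_nat.
- move=> _ [x Px <-].
  apply: (scale_net_sub K r B2K KrB2 m a eps net) => //.
  by rewrite epsE.
- by move=> x Kx i; apply: (dot_le_support K r KrB2).
Qed.
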